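(* Let $n\ge 1$ and let $\mathbb{F}_q$ be a finite field. The discrete series character $\delta(n,\mathbb{F}_q)$ is equal to a sum of cluster characters of $U(n,\mathbb{F}_q)$. For every coadjoint template $\tau\in\mathcal{T}^*(n,\mathbb{F}_q)$ the multiplicity of $\chi(\tau)$ in $\delta(n,\mathbb{F}_q)$ is equal to $$q^{d(\tau)-i(\tau)}\cdot\prod_{k\in Z(\tau)}\left[1-\frac{1}{q^{d(k,\tau)}}\right],$$ where $Z(\tau)$ is the set of indices $1\le k\le n-1$ such that $\mathrm{supp}(\tau)$ contains no position in the $k$-th row.
   Context: $U(n,\mathbb{F}_q)$ is the group of upper triangular unipotent $n\times n$ matrices over $\mathbb{F}_q$, $\mathfrak{u}(n,\mathbb{F}_q)$ is the algebra of upper triangular nilpotent (strictly upper triangular) matrices, with basis the matrix units $e_{ij}$ ($1\le i<j\le n$), and $\mathfrak{u}^*(n,\mathbb{F}_q)$ is its $\mathbb{F}_q$-linear dual. For $\lambda\in\mathfrak{u}^*(n,\mathbb{F}_q)$, $\mathrm{supp}(\lambda)$ is the set of positions $(i,j)$ with $\lambda(e_{ij})\ne 0$. $\mathcal{T}^*(n,\mathbb{F}_q)$ is the set of coadjoint templates: those $\tau$ whose support contains at most one position in each row and each column. $U(n,\mathbb{F}_q)$ acts on $\mathfrak{u}^*(n,\mathbb{F}_q)$ by the left action $(g*\lambda)(X)=\lambda(Xg)$ and the right action $(\lambda*g)(X)=\lambda(gX)$, which commute; $L(\lambda)$ and $R(\lambda)$ are the orbits of $\lambda$ under the left and right actions.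 Put $\widehat L(\lambda)=L(\lambda)-\lambda$ and $\widehat R(\lambda)=R(\lambda)-\lambda$ (translates), which are linear subspaces of $\mathfrak{u}^*(n,\mathbb{F}_q)$ of equal dimension. Define $d(\lambda)=\dim\widehat L(\lambda)=\dim\widehat R(\lambda)$ and $i(\lambda)=\dim(\widehat L(\lambda)\cap\widehat R(\lambda))$. For $\tau\in\mathcal{T}^*(n,\mathbb{F}_q)$ and $1\le k\le n-1$, $d(k,\tau)$ is the dimension of the subspace of those $\lambda\in\widehat R(\tau)$ whose support contains only positions (if any) in the $k$-th row. Fix a non-trivial homomorphism $\theta$ from the additive group of $\mathbb{F}_q$ to $\mathbb{C}^\times$. Let $\mathbb{C}[U(n,\mathbb{F}_q)]$ be the space of complex-valued functions on $U(n,\mathbb{F}_q)$, carrying the regular representation $(g*v)(g')=v(g'g)$, and put $v(\lambda)(g)=\theta[\lambda(g-I)]$. The span $V(\lambda)$ of $\{v(\mu):\mu\in L(\lambda)\}$ is a submodule of the regular representation; its character $\chi(\lambda)$ is called a cluster character. Every cluster character equals $\chi(\tau)$ for exactly one $\tau\in\mathcal{T}^*(n,\mathbb{F}_q)$, and the cluster characters are mutually orthogonal, hence linearly independent; ''multiplicity of $\chi(\tau)$'' means the coefficient of $\chi(\tau)$ in the expression as a linear combination of cluster characters. Let $\Delta(n,\mathbb{F}_q)$ be the set of $\lambda\in\mathfrak{u}^*(n,\mathbb{F}_q)$ such that $\mathrm{supp}(\lambda)$ contains at least one position in each of the first $n-1$ rows; it is closed under the left action. The span of $\{v(\lambda):\lambda\in\Delta(n,\mathbb{F}_q)\}$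 is a submodule of the regular representation, and the discrete series character $\delta(n,\mathbb{F}_q)$ is by definition its character. *)

(* Defs.v *)
From HB Require Import structures.
From mathcomp Require Import all_boot all_order all_algebra all_fingroup all_field.

Set Implicit Arguments.
Unset Strict Implicit.
Unset Printing Implicit Defensive.

Import Order.TTheory GRing.Theory Num.Theory.

Local Open Scope ring_scope.

Section UnitriangularGroup.

Variables (n : nat) (F : finFieldType).

Definition is_unitri (A : 'M[F]_n) : bool :=
  [forall i : 'I_n, forall j : 'I_n, (j <= i)%N ==> (A i j == (i == j)%:R)].

Lemma is_unitriP (A : 'M[F]_n) :
  reflect (forall i j : 'I_n, (j <= i)%N -> A i j = (i == j)%:R) (is_unitri A).
Proof.
apply: (iffP 'forall_forallP) => [H i j ij | H i j].
  by apply/eqP; move: (H i j); rewrite ij.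
by apply/implyP => ij; apply/eqP/H.
Qed.

Record unitri : predArgType :=
  Unitri { unitri_mx :> 'M[F]_n; unitri_mxP : is_unitri unitri_mx }.

HB.instance Definition _ := [isSub for unitri_mx].
HB.instance Definition _ := [Finite of unitri by <:].

Lemma is_unitri1 : is_unitri 1%:M.
Proof. by apply/is_unitriP => i j _; rewrite mxE. Qed.

Lemma is_unitriM (A B : 'M[F]_n) :
  is_unitri A -> is_unitri B -> is_unitri (A *m B).
Proof.
move=> /is_unitriP uA /is_unitriP uB; apply/is_unitriP => i j leji.
rewrite mxE (bigD1 i) //= uA // eqxx mul1r uB // big1 ?addr0 // => k neki.
case: (leqP k i) => [leki | ltik].
  by rewrite uA // eq_sym (negPf neki) mul0r.
rewrite (uB k) ?(leq_trans leji (ltnW ltik)) //.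
by rewrite -val_eqE /= gtn_eqF ?mulr0 // (leq_ltn_trans leji).
Qed.

Lemma unitri_unitmx (A : 'M[F]_n) : is_unitri A -> A \in unitmx.
Proof.
move=> /is_unitriP uA; rewrite unitmxE -det_tr det_trig.
  by rewrite big1 ?unitr1 // => i _; rewrite mxE uA // eqxx.
apply/is_trig_mxP => i j ltij.
by rewrite mxE uA ?(ltnW ltij) // -val_eqE /= gtn_eqF.
Qed.

Definition unitri_one := Unitri is_unitri1.
Definition unitri_mul (g h : unitri) :=
  Unitri (is_unitriM (unitri_mxP g) (unitri_mxP h)).

Lemma is_unitriV (g : unitri) : is_unitri (invmx g).
Proof.
have ug := unitri_unitmx (unitri_mxP g).
have inj_mul : injective (unitri_mul ^~ g).
  by move=> x y /(congr1 val) /(can_inj (mulmxK ug)) /val_inj.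
have /(congr1 (fun h => val h *m invmx g)) := f_invF inj_mul unitri_one.
by rewrite /= mulmxK // mul1mx => <-; apply: unitri_mxP.
Qed.

Definition unitri_inv (g : unitri) := Unitri (is_unitriV g).

Lemma unitri_mulA : associative unitri_mul.
Proof. by move=> x y z; apply/val_inj/mulmxA. Qed.

Lemma unitri_mul1 : left_id unitri_one unitri_mul.
Proof. by move=> x; apply/val_inj/mul1mx. Qed.

Lemma unitri_mulV : left_inverse unitri_one unitri_inv unitri_mul.
Proof. by move=> x; apply/val_inj/mulVmx/unitri_unitmx/unitri_mxP. Qed.

HB.instance Definition _ :=
  Finite_isGroup.Build unitri unitri_mulA unitri_mul1 unitri_mulV.

End UnitriangularGroup.

Section DualSpace.

Variables (n : nat) (F : finFieldType).

Definition upper_units : seq 'M[F]_n :=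
  [seq delta_mx p.1 p.2 | p : 'I_n * 'I_n <- enum {: 'I_n * 'I_n}
                        & (p.1 < p.2)%N].

Definition strict_upper : {vspace 'M[F]_n} := <<upper_units>>%VS.

Lemma mem_strict_upper (X : 'M[F]_n) :
  reflect (forall i j : 'I_n, (j <= i)%N -> X i j = 0) (X \in strict_upper).
Proof.
apply: (iffP idP) => [uX i j leji | X0].
  rewrite (coord_span (X := in_tuple upper_units) uX) summxE big1 // => k _.
  rewrite mxE.
  have /mapP[p] : (in_tuple upper_units)`_k \in upper_units by rewrite mem_nth.
  rewrite mem_filter => /andP[ltp _] ->; rewrite mxE.
  case: eqP => [ei|]; case: eqP => [ej|]; rewrite ?mulr0 //.
  by move: ltp; rewrite -ei -ej ltnNge leji.
rewrite (matrix_sum_delta X); apply: rpred_sum => i _; apply: rpred_sum => j _.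
case: (leqP j i) => [/X0 -> | ltij]; first by rewrite scale0r mem0v.
apply/rpredZ/memv_span/mapP; exists (i, j) => //.
by rewrite mem_filter ltij mem_enum.
Qed.

Definition nilalg := subvs_of strict_upper.

(* finvect_type only makes the finite set of linear forms a finType. *)
Definition dual := finvect_type 'Hom(nilalg, F^o).

Definition ev (lam : dual) (X : nilalg) : F := (lam : 'Hom(nilalg, F^o)) X.

(* In the next three definitions the matrix given to [vsproj] lies in
   [strict_upper], so that [vsproj] is just the coercion to [nilalg]. *)
Definition lact_fun (g : unitri n F) (lam : dual) (X : nilalg) : F^o :=
  ev lam (vsproj strict_upper (vsval X *m g)).

Definition ract_fun (lam : dual) (g : unitri n F) (X : nilalg) : F^o :=
  ev lam (vsproj strict_upper (g *m vsval X)).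

Definition supp (lam : dual) : {set 'I_n * 'I_n} :=
  [set p : 'I_n * 'I_n | (p.1 < p.2)%N &
    ev lam (vsproj strict_upper (delta_mx p.1 p.2)) != 0].

Lemma mul_strict_upper_unitri (X : nilalg) (g : unitri n F) :
  vsval X *m g \in strict_upper.
Proof.
have /mem_strict_upper X0 := subvsP X; have /is_unitriP ug := unitri_mxP g.
apply/mem_strict_upper => i j leji; rewrite mxE big1 // => k _.
case: (leqP k i) => [/X0 -> | ltik]; first by rewrite mul0r.
rewrite ug ?(leq_trans leji (ltnW ltik)) // -val_eqE /=.
by rewrite gtn_eqF ?mulr0 // (leq_ltn_trans leji).
Qed.

Lemma mul_unitri_strict_upper (g : unitri n F) (X : nilalg) :
  g *m vsval X \in strict_upper.
Proof.
have /mem_strict_upper X0 := subvsP X; have /is_unitriP ug := unitri_mxP g.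
apply/mem_strict_upper => i j leji; rewrite mxE big1 // => k _.
case: (leqP j k) => [/X0 -> | ltkj]; first by rewrite mulr0.
have ltki := leq_trans ltkj leji.
by rewrite ug ?(ltnW ltki) // -val_eqE /= gtn_eqF ?mul0r.
Qed.

Lemma unitri_sub1_strict_upper (g : unitri n F) :
  unitri_mx g - 1%:M \in strict_upper.
Proof.
have /is_unitriP ug := unitri_mxP g.
by apply/mem_strict_upper => i j leji; rewrite !mxE ug // subrr.
Qed.

Lemma lact_fun_is_linear g lam : linear (lact_fun g lam).
Proof.
by move=> a X Y; rewrite /lact_fun /ev linearP /= mulmxDl -scalemxAl !linearP.
Qed.
HB.instance Definition _ g lam :=
  GRing.isLinear.Build _ _ _ _ (lact_fun g lam) (lact_fun_is_linear g lam).

Lemma ract_fun_is_linear lam g : linear (ract_fun lam g).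
Proof.
move=> a X Y; rewrite /ract_fun /ev [vsval _]linearP mulmxDr -scalemxAr.
by rewrite !linearP.
Qed.
HB.instance Definition _ lam g :=
  GRing.isLinear.Build _ _ _ _ (ract_fun lam g) (ract_fun_is_linear lam g).

Definition lact (g : unitri n F) (lam : dual) : dual := linfun (lact_fun g lam).
Definition ract (lam : dual) (g : unitri n F) : dual := linfun (ract_fun lam g).

Lemma lactE g lam X :
  ev (lact g lam) X = ev lam (vsproj strict_upper (vsval X *m g)).
Proof. by rewrite {1}/ev lfunE. Qed.

Lemma ractE lam g X :
  ev (ract lam g) X = ev lam (vsproj strict_upper (g *m vsval X)).
Proof. by rewrite {1}/ev lfunE. Qed.

Definition is_template (lam : dual) : bool :=
  [forall i : 'I_n, #|[set p in supp lam | p.1 == i]| <= 1]%N &&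
  [forall j : 'I_n, #|[set p in supp lam | p.2 == j]| <= 1]%N.

Definition Lorbit (lam : dual) : {set dual} := [set lact g lam | g : unitri n F].
Definition Rorbit (lam : dual) : {set dual} := [set ract lam g | g : unitri n F].

Definition Lhat (lam : dual) : {set dual} := [set mu - lam | mu in Lorbit lam].
Definition Rhat (lam : dual) : {set dual} := [set mu - lam | mu in Rorbit lam].

(* Only applied to sets that are already linear subspaces of the dual. *)
Definition dimset (A : {set dual}) : nat := \dim <<enum A>>%VS.

Definition d_dim (lam : dual) : nat := dimset (Lhat lam).
Definition i_dim (lam : dual) : nat := dimset (Lhat lam :&: Rhat lam).

Lemma i_dim_le_d_dim lam : (i_dim lam <= d_dim lam)%N.
Proof.
apply/dimvS/sub_span => mu; rewrite !mem_enum => /setIP[muL _]; exact: muL.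
Qed.

(* Rows are numbered from 0, so the first n - 1 rows are those with k.+1 < n. *)
Definition row_dim (k : 'I_n) (tau : dual) : nat :=
  dimset [set mu in Rhat tau | [forall p in supp mu, p.1 == k]].

Definition empty_rows (tau : dual) : {set 'I_n} :=
  [set k : 'I_n | (k.+1 < n)%N & [forall p in supp tau, p.1 != k]].

Definition Delta : {set dual} :=
  [set lam | [forall k : 'I_n, (k.+1 < n)%N ==> [exists p in supp lam, p.1 == k]]].

End DualSpace.

Section Characters.

Variables (n : nat) (F : finFieldType) (C : numClosedFieldType).

Notation U := (unitri n F).
Notation CU := {ffun U -> C^o}.

Definition regular_act (g : U) (v : CU) : CU := [ffun h => v (h * g)%g].

(* The trace of g on W, computed in the basis [vbasis W]; meaningful for a
   submodule W, i.e. when W is stable under [regular_act]. *)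
Definition submodule_char (W : {vspace CU}) : CU :=
  [ffun g => \tr (\matrix_(i < \dim W, j < \dim W)
                    coord (vbasis W) j (regular_act g (vbasis W)`_i))].

Definition nontrivial_additive_char (theta : F -> C) : Prop :=
  [/\ forall x, theta x != 0,
      forall x y, theta (x + y) = theta x * theta y
    & exists x, theta x != 1].

Variable theta : F -> C.

Definition vfun (lam : dual n F) : CU :=
  [ffun g => theta (ev lam (vsproj (strict_upper n F) (unitri_mx g - 1%:M)))].

Definition vspan (A : {set dual n F}) : {vspace CU} :=
  <<[seq vfun mu | mu in A]>>%VS.

Definition cluster_char (lam : dual n F) : CU :=
  submodule_char (vspan (Lorbit lam)).

Definition discrete_series_char : CU := submodule_char (vspan (Delta n F)).

(* [f] is a linear combination of the cluster characters, and [c] is the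
   coefficient of [cluster_char tau] in every such expression; each cluster
   character is listed exactly once, through its template. *)
Definition cluster_multiplicity (f : CU) (tau : dual n F) (c : C) : Prop :=
  let expands (m : dual n F -> C) :=
    f = \sum_(sigma | is_template sigma) m sigma *: cluster_char sigma in
  (exists m, expands m) /\ (forall m, expands m -> m tau = c).

End Characters.

(* Main.v *)
Require Import Defs.
From HB Require Import structures.
From mathcomp Require Import all_boot all_order all_algebra all_fingroup all_field.
From mathcomp Require Import reals complex.

(* [ract] is also the name of the restriction of an action in fingroup. *)
Import Defs.

Set Implicit Arguments.
Unset Strict Implicit.
Unset Printing Implicit Defensive.

Import Order.TTheory GRing.Theory Num.Theory.

Local Open Scope ring_scope.

(** The argument is Fourier analysis on the finite group U.  The functions
    v(lam) are the additive characters X |-> theta (lam X) read through the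
    bijection g |-> g - 1, so they are orthogonal [sum_vfun], and U permutes
    them up to scalars: g v(lam) = v(lam)(g) v(g lam).  The trace of g on the
    span of a left-stable set A is therefore the sum of v(lam)(g) over the lam
    in A fixed by g.  The identity
      (g lam - lam) (h - 1) = (lam h - lam) (g - 1)       [evm_actB]
    turns the condition g lam = lam into a character sum over h, and gives
      |U| chi_A = sum over lam in A and h in U of v(lam h)
                                                  [submodule_char_ract].

    Three consequences follow.  The character of a left orbit depends only on
    the two-sided orbit.  The set Delta is a union of left orbits, so the
    discrete series is a sum of cluster characters.  Finally the coefficient
    of v(tau) in |U| chi_A is the number of h with tau h in A
    [vcoef_submodule_char].

    Each two-sided orbit contains exactly one template [template_exists,
    template_unique], so the coefficient of v(tau) vanishes on every cluster
    character of another template.  Comparing the coefficients of v(tau) in an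
    expansion of the discrete series then determines the multiplicity of
    chi(tau): it is the number of h with tau h in Delta, divided by the number
    of h with tau h in L(tau), that is |Delta :&: R(tau)| / |L(tau) :&: R(tau)|.

    The denominator is q ^ i(tau), by translation.  For the numerator, the
    subspace R(tau) - tau of a template consists of the forms supported at the
    positions strictly below a position of tau, in its column
    [mem_Rhat_template].  It is the direct sum of its row components, of size
    q ^ d(k,tau).  A form tau + mu in R(tau) lies in Delta precisely when mu is
    nonzero in each empty row of tau, so the count is a product over rows.
    The total number of choices is |R(tau)| = |L(tau)| = q ^ d(tau), where the
    first equality comes from evaluating one double character sum in two
    orders [card_stab_lact_ract]. *)

(** * Linear forms and their entries *)

Section Coefficients.
Variables (n : nat) (F : finFieldType).
Implicit Types (lam mu : dual n F) (g h : unitri n F) (X Y : 'M[F]_n).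

(** A form is only defined on strictly upper triangular matrices; composing it with
    the projection onto them makes it a linear map on all matrices, and spares
    the coercions to and from the subspace. *)
Definition evm lam X : F := ev lam (vsproj (strict_upper n F) X).

Fact evm_is_linear lam : linear (evm lam : 'M[F]_n -> F^o).
Proof. by move=> a X Y; rewrite /evm /ev !linearP. Qed.
HB.instance Definition _ lam :=
  GRing.isLinear.Build F 'M[F]_n F^o _ (evm lam : 'M[F]_n -> F^o)
    (evm_is_linear lam).

Lemma evm_vsval lam (X : nilalg n F) : evm lam (vsval X) = ev lam X.
Proof. by rewrite /evm vsvalK. Qed.

Lemma evmDl a lam mu X : evm (a *: lam + mu) X = a * evm lam X + evm mu X.
Proof. by rewrite /evm /ev; rewrite add_lfunE scale_lfunE. Qed.

Lemma evmBl lam mu X : evm (lam - mu) X = evm lam X - evm mu X.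
Proof. by rewrite -scaleN1r addrC evmDl mulN1r addrC. Qed.

Lemma evm0l X : evm 0 X = 0.
Proof. by rewrite -(subrr 0) evmBl subrr. Qed.

Lemma evm_lact g lam X : X \in strict_upper n F ->
  evm (lact g lam) X = evm lam (X *m g).
Proof. by move=> uX; rewrite /evm lactE vsprojK. Qed.

Lemma evm_ract g lam X : X \in strict_upper n F ->
  evm (ract lam g) X = evm lam (g *m X).
Proof. by move=> uX; rewrite /evm ractE vsprojK. Qed.

Lemma dual_eqP lam mu :
  (forall X, X \in strict_upper n F -> evm lam X = evm mu X) -> lam = mu.
Proof.
move=> eq_lm; apply/lfunP => X; have := eq_lm _ (subvsP X).
by rewrite !evm_vsval.
Qed.

Lemma strict_upperZD a X Y : X \in strict_upper n F -> Y \in strict_upper n F ->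
  a *: X + Y \in strict_upper n F.
Proof. by move=> uX uY; rewrite rpredD ?rpredZ. Qed.

Lemma is_unitri_add1 X : X \in strict_upper n F -> is_unitri (1%:M + X).
Proof.
move=> /mem_strict_upper X0; apply/is_unitriP => i j leji.
by rewrite !mxE X0 // addr0.
Qed.

Lemma strict_upper_mulr X g : X \in strict_upper n F ->
  X *m g \in strict_upper n F.
Proof.
by move=> uX; have := mul_strict_upper_unitri (Subvs uX) g.
Qed.

Lemma strict_upper_mull X g : X \in strict_upper n F ->
  g *m X \in strict_upper n F.
Proof.
by move=> uX; have := mul_unitri_strict_upper g (Subvs uX).
Qed.

Lemma delta_strict_upper (i j : 'I_n) : (i < j)%N ->
  delta_mx i j \in strict_upper n F.
Proof.
move=> ltij; apply/mem_strict_upper => a b leba; rewrite mxE.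
case: eqP => // ea; case: eqP => // eb.
by move: leba; rewrite ea eb leqNgt ltij.
Qed.

Lemma lactM g h lam : lact (g * h)%g lam = lact g (lact h lam).
Proof.
apply: dual_eqP => X uX; rewrite !evm_lact ?strict_upper_mulr //=.
by rewrite mulmxA.
Qed.

Lemma lact1 lam : lact 1%g lam = lam.
Proof. by apply: dual_eqP => X uX; rewrite evm_lact // mulmx1. Qed.

Lemma ractM lam g h : ract lam (g * h)%g = ract (ract lam g) h.
Proof.
apply: dual_eqP => X uX; rewrite !evm_ract ?strict_upper_mull //=.
by rewrite mulmxA.
Qed.

Lemma ract1 lam : ract lam 1%g = lam.
Proof. by apply: dual_eqP => X uX; rewrite evm_ract // mul1mx. Qed.

Lemma lact_ract g lam h : lact g (ract lam h) = ract (lact g lam) h.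
Proof.
apply: dual_eqP => X uX.
rewrite evm_lact // !evm_ract ?strict_upper_mulr //.
rewrite evm_lact ?strict_upper_mull //.
by rewrite mulmxA.
Qed.

Lemma lactK g : cancel (lact g) (lact g^-1%g).
Proof. by move=> lam; rewrite -lactM mulVg lact1. Qed.

Lemma ractK g : cancel ((@ract n F)^~ g) ((@ract n F)^~ g^-1%g).
Proof. by move=> lam; rewrite /= -ractM mulgV ract1. Qed.

Lemma ractVK g : cancel ((@ract n F)^~ g^-1%g) ((@ract n F)^~ g).
Proof. by move=> lam; rewrite /= -ractM mulVg ract1. Qed.

(** Set to 0 outside the strictly upper triangular positions, so that [entry] is
    total and a form is determined by its matrix of entries. *)
Definition entry lam (i j : 'I_n) : F :=
  if (i < j)%N then evm lam (delta_mx i j) else 0.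

Lemma entry_neq0_lt lam i j : entry lam i j != 0 -> (i < j)%N.
Proof. by rewrite /entry; case: ifP; rewrite ?eqxx. Qed.

Lemma mem_supp lam p : (p \in supp lam) = (entry lam p.1 p.2 != 0).
Proof. by rewrite inE /entry -/(evm _ _); case: ifP => //=; rewrite eqxx. Qed.

Lemma entryD a lam mu i j :
  entry (a *: lam + mu) i j = a * entry lam i j + entry mu i j.
Proof. by rewrite /entry; case: ifP; rewrite ?evmDl // mulr0 addr0. Qed.

Lemma entryB lam mu i j : entry (lam - mu) i j = entry lam i j - entry mu i j.
Proof. by rewrite /entry; case: ifP; rewrite ?evmBl // subr0. Qed.

Lemma entry0 i j : entry 0 i j = 0.
Proof. by rewrite -(subrr 0) entryB subrr. Qed.

Lemma evm_coef lam X : X \in strict_upper n F ->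
  evm lam X = \sum_i \sum_j X i j * entry lam i j.
Proof.
move=> /mem_strict_upper X0; rewrite {1}[X]matrix_sum_delta linear_sum.
apply: eq_bigr => i _; rewrite linear_sum; apply: eq_bigr => j _ /=.
transitivity (X i j * evm lam (delta_mx i j)); first exact: linearZ.
by rewrite /entry; case: ltnP => // /X0 ->; rewrite !mul0r.
Qed.

Lemma entry_inj lam mu : (forall i j, entry lam i j = entry mu i j) -> lam = mu.
Proof.
move=> eq_lm; apply: dual_eqP => X uX; rewrite !evm_coef //.
by apply: eq_bigr => i _; apply: eq_bigr => j _; rewrite eq_lm.
Qed.

Lemma delta_mulmx (i j : 'I_n) X a b :
  (delta_mx i j *m X) a b = (a == i)%:R * X j b.
Proof.
rewrite mxE (bigD1 j) //= big1 ?addr0 ?mxE ?eqxx ?andbT //.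
by move=> k /negPf nkj; rewrite mxE nkj andbF mul0r.
Qed.

Lemma mulmx_delta (i j : 'I_n) X a b :
  (X *m delta_mx i j) a b = X a i * (b == j)%:R.
Proof.
rewrite mxE (bigD1 i) //= big1 ?addr0 ?mxE ?eqxx //.
by move=> k /negPf nkj; rewrite mxE nkj mulr0.
Qed.

Lemma entry_lact g lam (i j : 'I_n) : (i < j)%N ->
  entry (lact g lam) i j =
    entry lam i j + \sum_(k < n | (j < k)%N) g j k * entry lam i k.
Proof.
move=> ltij; have ud := delta_strict_upper ltij.
rewrite {1}/entry ltij evm_lact // evm_coef ?strict_upper_mulr //.
rewrite (bigD1 i) //= [X in _ + X]big1 => [|a /negPf nai]; last first.
  by apply: big1 => b _; rewrite delta_mulmx nai mul0r mul0r.
rewrite addr0 (bigD1 j) //= delta_mulmx eqxx mul1r.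
have /is_unitriP ug := unitri_mxP g.
rewrite ug // eqxx mul1r; congr (_ + _).
rewrite [LHS](bigID (fun k : 'I_n => (j < k)%N)) /=.
rewrite [X in _ + X]big1 => [|k]; last first.
  rewrite -leqNgt => /andP[nkj lekj].
  by rewrite delta_mulmx ug // [j == k]eq_sym (negPf nkj) mulr0 mul0r.
rewrite addr0; apply: eq_big => k.
  by rewrite andb_idl // => ltjk; rewrite -val_eqE /= gtn_eqF.
by rewrite delta_mulmx eqxx mul1r.
Qed.

Lemma entry_ract h lam (i j : 'I_n) : (i < j)%N ->
  entry (ract lam h) i j =
    entry lam i j + \sum_(k < n | (k < i)%N) h k i * entry lam k j.
Proof.
move=> ltij; have ud := delta_strict_upper ltij.
rewrite {1}/entry ltij evm_ract // evm_coef ?strict_upper_mull //.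
have /is_unitriP uh := unitri_mxP h.
transitivity (\sum_k h k i * entry lam k j).
  apply: eq_bigr => k _.
  rewrite (bigD1 j) //= mulmx_delta eqxx mulr1 big1 ?addr0 //.
  by move=> b /negPf nbj; rewrite mulmx_delta nbj mulr0 mul0r.
rewrite (bigD1 i) //= uh // eqxx mul1r; congr (_ + _).
rewrite [LHS](bigID (fun k : 'I_n => (k < i)%N)) /=.
rewrite [X in _ + X]big1 => [|k]; last first.
  rewrite -leqNgt => /andP[nki leik].
  by rewrite uh // (negPf nki) mul0r.
rewrite addr0; apply: eq_bigl => k.
by rewrite andb_idl // => ltki; rewrite -val_eqE /= ltn_eqF.
Qed.

Definition mx_pairing (A : 'M[F]_n) (X : nilalg n F) : F^o :=
  \sum_i \sum_j vsval X i j * A i j.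

Fact mx_pairing_is_linear A : linear (mx_pairing A).
Proof.
move=> a X Y; rewrite scaler_sumr -big_split; apply: eq_bigr => i _ /=.
rewrite scaler_sumr -big_split; apply: eq_bigr => j _ /=.
by rewrite !mxE mulrDl -mulrA.
Qed.
HB.instance Definition _ A :=
  GRing.isLinear.Build F (nilalg n F) F^o _ (mx_pairing A)
    (mx_pairing_is_linear A).

Definition dual_of_mx A : dual n F := linfun (mx_pairing A).

Lemma entry_dual_of_mx A (i j : 'I_n) : (i < j)%N ->
  entry (dual_of_mx A) i j = A i j.
Proof.
move=> ltij; rewrite /entry ltij /evm /ev lfunE /= /mx_pairing.
rewrite vsprojK ?delta_strict_upper //.
rewrite (bigD1 i) //= (bigD1 j) //= mxE !eqxx mul1r !big1 ?addr0 //.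
  by move=> a /negPf na; apply: big1 => b _; rewrite mxE na mul0r.
by move=> b /negPf nb; rewrite mxE nb andbF mul0r.
Qed.

End Coefficients.

(** * Orthogonality of the functions v(lam) *)

Section AdditiveCharacters.
Variables (n : nat) (F : finFieldType) (C : numClosedFieldType).
Variables (theta : F -> C) (theta_char : nontrivial_additive_char theta).
Implicit Types (lam mu : dual n F) (g h : unitri n F).

Lemma theta0 : theta 0 = 1.
Proof.
case: theta_char => nz thD _; apply: (mulfI (nz 0)).
by rewrite -thD addr0 mulr1.
Qed.

Lemma vfunE lam g : vfun theta lam g = theta (evm lam (unitri_mx g - 1%:M)).
Proof. by rewrite ffunE. Qed.

Lemma vfunB lam mu g :
  vfun theta lam g = vfun theta (lam - mu) g * vfun theta mu g.
Proof.
case: theta_char => _ thD _; rewrite !vfunE evmBl -thD.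
by rewrite subrK.
Qed.

Lemma vfun0 g : vfun theta 0 g = 1.
Proof. by rewrite vfunE evm0l theta0. Qed.

Lemma vfun_neq0 lam g : vfun theta lam g != 0.
Proof. by case: theta_char => nz _ _; rewrite vfunE. Qed.

(** The shift g |-> g + Y by a strictly upper triangular Y permutes U and multiplies
    the sum by theta (lam Y), which can be made different from 1 when lam is
    nonzero. *)
Lemma sum_vfun lam :
  \sum_g vfun theta lam g = (if lam == 0 then #|[set: unitri n F]|%:R else 0).
Proof.
case: eqVneq => [-> | nz_lam].
  under eq_bigr do rewrite vfun0.
  by rewrite sumr_const cardsT.
have [X uX nzX]: exists2 X, X \in strict_upper n F & evm lam X != 0.
  have [|/existsP[X] nzX] := boolP
    [forall X : 'M[F]_n, (X \in strict_upper n F) ==> (evm lam X == 0)].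
    move=> /forallP lam0; case/eqP: nz_lam; apply: dual_eqP => X uX.
    by rewrite evm0l; apply/eqP/(implyP (lam0 X)).
  by exists X; move: nzX; rewrite negb_imply => /andP[].
case: theta_char => nz thD [x thx].
pose Y := (x / evm lam X) *: X.
have uY : Y \in strict_upper n F by rewrite rpredZ.
have lamY : evm lam Y = x.
  transitivity (x / evm lam X * evm lam X); first exact: linearZ.
  by rewrite divfK.
have uT g : is_unitri (unitri_mx g + Y).
  have := is_unitri_add1 (rpredD (unitri_sub1_strict_upper g) uY).
  by rewrite addrA [1%:M + _]addrC subrK.
pose shift g := Unitri (uT g).
have shift_inj : injective shift.
  by move=> g h /(congr1 val) /addIr /val_inj.
set S := LHS.
have : S = S * theta x.
  rewrite {1}/S (reindex_inj shift_inj) mulr_suml; apply: eq_bigr => g _.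
  rewrite !vfunE -thD; congr theta.
  rewrite /= addrAC; transitivity (evm lam (unitri_mx g - 1%:M) + evm lam Y).
    exact: linearD.
  by rewrite lamY.
move/eqP; rewrite -{1}[S]mulr1 -subr_eq0 -mulrBr mulf_eq0 => /orP[/eqP //|].
by rewrite subr_eq0 eq_sym (negPf thx).
Qed.

(** Both sides are lam ((h - 1) (g - 1)). *)
Lemma evm_actB g h lam :
  evm (lact g lam - lam) (unitri_mx h - 1%:M) =
  evm (ract lam h - lam) (unitri_mx g - 1%:M).
Proof.
rewrite !evmBl evm_lact ?evm_ract ?unitri_sub1_strict_upper //.
transitivity
  (evm lam ((unitri_mx h - 1%:M) *m unitri_mx g - (unitri_mx h - 1%:M))).
  exact/esym/linearB.
transitivity
  (evm lam (unitri_mx h *m (unitri_mx g - 1%:M) - (unitri_mx g - 1%:M))).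
  congr evm; rewrite mulmxBl mulmxBr mul1mx mulmx1 !opprB !addrA.
  by rewrite [LHS]addrAC [RHS]addrAC; congr (_ + _); rewrite addrAC.
exact: linearB.
Qed.

(** This is how the condition g lam = lam is written as a sum of functions v. *)
Lemma sum_vfun_ract lam g :
  \sum_h vfun theta (ract lam h) g =
  if lact g lam == lam then #|[set: unitri n F]|%:R * vfun theta lam g else 0.
Proof.
rewrite -subr_eq0.
transitivity (\sum_h vfun theta (lact g lam - lam) h * vfun theta lam g).
  by apply: eq_bigr => h _; rewrite (vfunB _ lam) !vfunE evm_actB.
by rewrite -mulr_suml sum_vfun; case: ifP => // _; rewrite mul0r.
Qed.

(** The double sum of theta (lam ((h - 1) (g - 1))) over g and h is |U| times the
    order of the left stabiliser when summed over h first, and |U| times the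
    order of the right stabiliser when summed over g first. *)
Lemma card_stab_lact_ract lam :
  #|[set g | lact g lam == lam]| = #|[set h | ract lam h == lam]|.
Proof.
apply/eqP; have nzU : #|[set: unitri n F]|%:R != 0 :> C.
  by rewrite pnatr_eq0 -lt0n; apply/card_gt0P; exists 1%g; rewrite inE.
rewrite -(eqr_nat C) -(inj_eq (mulfI nzU)); apply/eqP.
have sumif (P : pred (unitri n F)) :
  \sum_g (if P g then #|[set: unitri n F]|%:R else 0) =
  #|[set: unitri n F]|%:R * #|[set g | P g]|%:R :> C.
  rewrite -big_mkcond sumr_const mulr_natr; congr (_ *+ _).
  by apply: eq_card => g; rewrite inE.
rewrite -!sumif.
transitivity (\sum_g \sum_h vfun theta (lact g lam - lam) h).
  by apply: eq_bigr => g _; rewrite sum_vfun subr_eq0.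
rewrite exchange_big; apply: eq_bigr => h _.
transitivity (\sum_g vfun theta (ract lam h - lam) g).
  by apply: eq_bigr => g _; rewrite !vfunE evm_actB.
by rewrite sum_vfun subr_eq0.
Qed.

(** The Fourier coefficient: division by v(mu)(g), which is the value v(-mu)(g),
    replaces complex conjugation. *)
Definition vcoef mu (f : {ffun unitri n F -> C^o}) : C :=
  #|[set: unitri n F]|%:R^-1 * \sum_g f g / vfun theta mu g.

Lemma vcoef_vfun mu lam : vcoef mu (vfun theta lam) = (lam == mu)%:R.
Proof.
rewrite /vcoef; under eq_bigr do rewrite (vfunB _ mu) mulfK ?vfun_neq0 //.
rewrite sum_vfun subr_eq0; case: ifP => _; last by rewrite mulr0.
rewrite mulVf // pnatr_eq0 -lt0n; apply/card_gt0P; exists 1%g; rewrite inE //.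
Qed.

Fact vcoef_is_linear mu : linear (vcoef mu : {ffun unitri n F -> C^o} -> C^o).
Proof.
move=> a f1 f2; rewrite /vcoef scalerAr scaler_sumr -mulrDr -big_split.
congr (_ * _); apply: eq_bigr => g _ /=.
by rewrite !ffunE mulrDl scalerAl.
Qed.
HB.instance Definition _ mu :=
  GRing.isLinear.Build C {ffun unitri n F -> C^o} C^o _ (vcoef mu)
    (vcoef_is_linear mu).

Lemma vcoefZ mu a f : vcoef mu (a *: f) = a * vcoef mu f.
Proof. exact: linearZ. Qed.

End AdditiveCharacters.

(** * Characters of spans of left-stable sets *)

(** Needed because the character is defined by the trace in [vbasis W], while it is
    computed in the basis of functions v. *)
Lemma trace_basis (K : fieldType) (vT : vectType K) (W : {vspace vT}) (m p : nat)
    (X : m.-tuple vT) (Y : p.-tuple vT) (f : {linear vT -> vT}) :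
  basis_of W X -> basis_of W Y -> (forall w, w \in W -> f w \in W) ->
  \sum_(i < m) coord X i (f X`_i) = \sum_(j < p) coord Y j (f Y`_j).
Proof.
move=> bX bY fW.
have memX (i : 'I_m) : X`_i \in W.
  by rewrite (basis_mem bX) ?mem_nth ?size_tuple.
have memY (j : 'I_p) : Y`_j \in W.
  by rewrite (basis_mem bY) ?mem_nth ?size_tuple.
transitivity (\sum_(i < m) \sum_(j < p) coord Y j (f X`_i) * coord X i Y`_j).
  apply: eq_bigr => i _; rewrite {1}(coord_basis bY (fW _ (memX i))) linear_sum.
  by apply: eq_bigr => j _; rewrite linearZ.
rewrite exchange_big; apply: eq_bigr => j _.
rewrite {2}(coord_basis bX (memY j)) !linear_sum.
by apply: eq_bigr => i _; rewrite !linearZ /= mulrC.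
Qed.

Section RegularRepresentation.
Variables (n : nat) (F : finFieldType) (C : numClosedFieldType).
Variables (theta : F -> C) (theta_char : nontrivial_additive_char theta).
Implicit Types (lam mu : dual n F) (g h : unitri n F) (A : {set dual n F}).

Fact regular_act_is_linear g : linear (@regular_act n F C g).
Proof. by move=> a v w; apply/ffunP => h; rewrite !ffunE. Qed.
HB.instance Definition _ g :=
  GRing.isLinear.Build C {ffun unitri n F -> C^o} {ffun unitri n F -> C^o} _
    (@regular_act n F C g) (regular_act_is_linear g).

Lemma regular_act_vfun g lam :
  regular_act g (vfun theta lam) = vfun theta lam g *: vfun theta (lact g lam).
Proof.
case: theta_char => _ thD _; apply/ffunP => h; rewrite ffunE [RHS]ffunE !vfunE.
rewrite -[_ *: _]/(_ * _) -thD evm_lact ?unitri_sub1_strict_upper //.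
congr theta.
transitivity
  (evm lam ((unitri_mx g - 1%:M) + (unitri_mx h - 1%:M) *m unitri_mx g)).
  by congr evm; rewrite mulmxBl mul1mx [RHS]addrC addrA subrK.
exact: linearD.
Qed.

Section Basis.
Variable A : {set dual n F}.
Let s := [seq vfun theta mu | mu in A].

Fact size_vfun_seq : size s = #|A|. Proof. exact: size_image. Qed.

Let idx (i : 'I_(size s)) : dual n F := enum_val (cast_ord size_vfun_seq i).

Lemma nth_vfun_seq (i : 'I_(size s)) : s`_i = vfun theta (idx i).
Proof. by rewrite -(nth_image 0). Qed.

(** Orthogonality makes the coefficient extractor [vcoef] the dual basis. *)
Lemma vcoef_sum (k : 'I_(size s) -> C) i :
  vcoef theta (idx i) (\sum_j k j *: s`_j) = k i.
Proof.
rewrite linear_sum (bigD1 i) //= big1 => [|j nji]; rewrite vcoefZ.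
  by rewrite nth_vfun_seq vcoef_vfun // eqxx addr0 mulr1.
rewrite nth_vfun_seq vcoef_vfun // (inj_eq enum_val_inj).
by rewrite (inj_eq (@cast_ord_inj _ _ _)) (negPf nji) mulr0.
Qed.

Lemma basis_vspan : basis_of (vspan theta A) (in_tuple s).
Proof.
rewrite /basis_of eqxx; apply/freeP => k k0 i.
by rewrite -(vcoef_sum k) k0 linear0.
Qed.

(** In the basis v, the action of g is monomial, so only the fixed points of g
    contribute to the trace. *)
Lemma submodule_char_vspan g : (forall mu, mu \in A -> lact g mu \in A) ->
  submodule_char (vspan theta A) g =
  \sum_(mu in A | lact g mu == mu) vfun theta mu g.
Proof.
move=> stA; rewrite ffunE /mxtrace.
have stW w : w \in vspan theta A -> regular_act g w \in vspan theta A.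
  move=> /(coord_basis basis_vspan) ->; rewrite linear_sum rpred_sum // => i _.
  rewrite linearZ rpredZ //= nth_vfun_seq regular_act_vfun.
  rewrite rpredZ // memv_span //.
  by apply/imageP; exists (lact g (idx i)); rewrite ?stA ?enum_valP.
under eq_bigr do rewrite mxE.
rewrite (trace_basis (f := regular_act g) (vbasisP _) basis_vspan stW).
rewrite [RHS]big_mkcondr [RHS]big_enum_val.
rewrite [RHS](reindex (cast_ord size_vfun_seq)); last first.
  apply: onW_bij; exists (cast_ord (esym size_vfun_seq)) => i.
    by rewrite cast_ordK.
  by rewrite cast_ordKV.
apply: eq_bigr => i _; rewrite -/(idx i).
have memW : regular_act g s`_i \in vspan theta A.
  by rewrite stW // (basis_mem basis_vspan) ?mem_nth.
rewrite -(vcoef_sum (fun j => coord (in_tuple s) j (regular_act g s`_i))).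
rewrite -(coord_basis basis_vspan memW) nth_vfun_seq regular_act_vfun.
by rewrite vcoefZ vcoef_vfun //; case: eqP; rewrite ?mulr1 ?mulr0.
Qed.

Lemma submodule_char_ract :
    (forall g mu, mu \in A -> lact g mu \in A) ->
  #|[set: unitri n F]|%:R *: submodule_char (vspan theta A) =
  \sum_(mu in A) \sum_h vfun theta (ract mu h).
Proof.
move=> stA; apply/ffunP => g.
rewrite ffunE sum_ffunE submodule_char_vspan => [|mu]; last exact: stA.
transitivity (\sum_(mu in A | lact g mu == mu)
                  #|[set: unitri n F]|%:R * vfun theta mu g).
  by rewrite -mulr_sumr.
rewrite big_mkcondr; apply: eq_bigr => mu _.
by rewrite sum_ffunE -sum_vfun_ract.
Qed.

End Basis.

Lemma mem_Lorbit_lact g lam mu : mu \in Lorbit lam -> lact g mu \in Lorbit lam.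
Proof.
by case/imsetP=> h _ ->; apply/imsetP; exists (g * h)%g; rewrite ?lactM.
Qed.

Lemma Lorbit_id lam : lam \in Lorbit lam.
Proof. by apply/imsetP; exists 1%g; rewrite ?lact1. Qed.

Lemma Lorbit_eq lam mu : mu \in Lorbit lam -> Lorbit mu = Lorbit lam.
Proof.
case/imsetP=> h _ ->; apply/setP => nu.
apply/imsetP/imsetP => [[g _ ->]|[g _ ->]].
  by exists (g * h)%g; rewrite ?lactM.
by exists (g * h^-1)%g; rewrite // lactM lactK.
Qed.

Lemma Lorbit_ract lam k :
  Lorbit (ract lam k) = (@ract n F)^~ k @: Lorbit lam.
Proof.
rewrite /Lorbit -imset_comp; apply: eq_imset => g /=; exact: lact_ract.
Qed.

(** The rightmost nonzero entry of a row is left unchanged by the column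
    operations of the left action. *)
Lemma Delta_lact g lam : lam \in Delta n F -> lact g lam \in Delta n F.
Proof.
rewrite !inE => /forallP D; apply/forallP => i; apply/implyP => lti.
have /existsP[[a b] /=] := implyP (D i) lti.
case/andP; rewrite mem_supp /= => nzb /eqP eai; rewrite {a}eai in nzb *.
have [c nzc cmax] :=
  @arg_maxnP _ b (fun c => entry lam i c != 0) (@nat_of_ord n) nzb.
apply/existsP; exists (i, c); rewrite mem_supp /= eqxx andbT.
rewrite entry_lact ?(entry_neq0_lt nzc) // big1 ?addr0 // => d ltcd.
case: (eqVneq (entry lam i d) 0) => [->|/cmax].
  by rewrite mulr0.
by rewrite /= leqNgt ltcd.
Qed.

Lemma cluster_char_ract lam :
  #|[set: unitri n F]|%:R *: cluster_char theta lam =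
  \sum_(mu in Lorbit lam) \sum_h vfun theta (ract mu h).
Proof. by apply: submodule_char_ract => g mu; apply: mem_Lorbit_lact. Qed.

Lemma cardU_neq0 : #|[set: unitri n F]|%:R != 0 :> C.
Proof. by rewrite pnatr_eq0 -lt0n; apply/card_gt0P; exists 1%g; rewrite inE. Qed.

(** In the double sum for |U| chi, the left factor g permutes the left orbit and the
    right factor k shifts the summation over h. *)
Lemma cluster_char_twosided lam g k :
  cluster_char theta (ract (lact g lam) k) = cluster_char theta lam.
Proof.
apply: (scalerI cardU_neq0); rewrite !cluster_char_ract Lorbit_ract.
rewrite (Lorbit_eq (mem_Lorbit_lact g (Lorbit_id lam))).
rewrite big_imset /= => [|mu nu _ _ /(can_inj (ractK k))//].
apply: eq_bigr => mu _; rewrite [RHS](reindex_inj (mulgI k)).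
by apply: eq_bigr => h _; rewrite ractM.
Qed.

Lemma discrete_series_sum_cluster : exists s : seq (dual n F),
  discrete_series_char n theta = \sum_(lam <- s) cluster_char theta lam.
Proof.
(* One representative of each left orbit in Delta. *)
pose rep (B : {set dual n F}) := odflt 0 [pick mu in B].
exists [seq rep B | B in (@Lorbit n F) @: Delta n F].
rewrite big_map big_enum /=; apply/ffunP => g.
rewrite sum_ffunE submodule_char_vspan => [|mu]; last exact: Delta_lact.
rewrite big_mkcondr (partition_big_imset (@Lorbit n F)) /=.
apply: eq_bigr => _ /imsetP[lam Dlam ->].
have rep_in : rep (Lorbit lam) \in Lorbit lam.
  by rewrite /rep; case: pickP => // /(_ lam); rewrite Lorbit_id.
rewrite submodule_char_vspan => [|mu]; last exact: mem_Lorbit_lact.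
rewrite (Lorbit_eq rep_in) [RHS]big_mkcondr; apply: eq_bigl => mu.
apply/andP/idP => [[_ /eqP <-]|/[dup] Lmu /Lorbit_eq ->].
  exact: Lorbit_id.
by case/imsetP: Lmu => h _ ->; rewrite eqxx Delta_lact.
Qed.

End RegularRepresentation.

(** * Templates *)

Section Templates.
Variables (n : nat) (F : finFieldType).
Implicit Types (lam mu tau sigma : dual n F) (g h : unitri n F).

Lemma suppE lam : supp lam = [set p | entry lam p.1 p.2 != 0].
Proof. by apply/setP => p; rewrite mem_supp inE. Qed.

Lemma is_templateP tau : reflect
  ((forall i j k, entry tau i j != 0 -> entry tau i k != 0 -> j = k) /\
   (forall i k j, entry tau i j != 0 -> entry tau k j != 0 -> i = k))
  (is_template tau).
Proof.
rewrite /is_template suppE.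
apply: (iffP andP) => [[/forallP rows /forallP cols] | [rows cols]]; split.
- move=> i j k nzj nzk; have /card_le1_eqP := rows i.
  move/(_ (i, j) (i, k)); rewrite !inE /= nzj nzk eqxx.
  by move=> /(_ isT isT) [].
- move=> i k j nzi nzk; have /card_le1_eqP := cols j.
  move/(_ (i, j) (k, j)); rewrite !inE /= nzi nzk eqxx.
  by move=> /(_ isT isT) [].
- apply/forallP => i; apply/card_le1_eqP => -[a b] [c d]; rewrite !inE /=.
  move=> /andP[nzb /eqP ea] /andP[nzd /eqP ec]; subst a c.
  by congr (_, _); apply: rows nzd nzb.
apply/forallP => j; apply/card_le1_eqP => -[a b] [c d]; rewrite !inE /=.
move=> /andP[nzb /eqP eb] /andP[nzd /eqP ed]; subst b d.
by congr (_, _); apply: cols nzd nzb.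
Qed.

Fact is_unitri_of_fun (f : 'I_n -> 'I_n -> F) :
  is_unitri (\matrix_(i, j) if (i < j)%N then f i j else (i == j)%:R).
Proof.
by apply/is_unitriP => i j leji; rewrite mxE ltnNge leji.
Qed.

Definition unitri_of_fun f : unitri n F := Unitri (is_unitri_of_fun f).

Lemma unitri_of_funE f (i j : 'I_n) : (i < j)%N -> unitri_of_fun f i j = f i j.
Proof. by move=> ltij; rewrite /= mxE ltij. Qed.

Lemma entry_ge lam (i j : 'I_n) : (j <= i)%N -> entry lam i j = 0.
Proof. by rewrite /entry leqNgt => /negPf->. Qed.

(** The group element whose only nontrivial column is the k-th adds multiples of
    column k to the columns before it. *)
Lemma entry_lact_col f (k : 'I_n) lam (i j : 'I_n) : (i < j)%N ->
  entry (lact (unitri_of_fun (fun a b => if b == k then f a else 0)) lam) i j =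
  entry lam i j + (if (j < k)%N then f j * entry lam i k else 0).
Proof.
move=> ltij; rewrite entry_lact //; congr (_ + _).
rewrite big_mkcond (bigD1 k) //= big1 ?addr0 => [|l /negPf nlk].
  by case: ifP => // ltjk; rewrite mxE ltjk eqxx.
by case: ifP => // ltjl; rewrite mxE ltjl nlk mul0r.
Qed.

Lemma entry_ract_row f (k : 'I_n) lam (i j : 'I_n) : (i < j)%N ->
  entry (ract lam (unitri_of_fun (fun a b => if a == k then f b else 0))) i j =
  entry lam i j + (if (k < i)%N then f i * entry lam k j else 0).
Proof.
move=> ltij; rewrite entry_ract //; congr (_ + _).
rewrite big_mkcond (bigD1 k) //= big1 ?addr0 => [|l /negPf nlk].
  by case: ifP => // ltki; rewrite mxE ltki eqxx.
by case: ifP => // ltli; rewrite mxE ltli nlk mul0r.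
Qed.

(** The first m rows are those of a template, and the columns of their nonzero
    entries are cleared in all rows. *)
Definition reduced_above m lam :=
  forall (i j : 'I_n), (i < m)%N -> entry lam i j != 0 ->
  (forall k, entry lam i k != 0 -> k = j) /\
  (forall k, entry lam k j != 0 -> k = i).

(** Gaussian elimination in row m: its rightmost nonzero entry, in column k, clears
    the rest of the row by column operations, then the rest of column k below it
    by row operations.  The rows above are zero in column k, and row m is zero in
    their pivot columns, so what was reduced stays reduced. *)
Lemma reduce_row lam (m : 'I_n) : reduced_above m lam ->
  exists g h, reduced_above m.+1 (ract (lact g lam) h).
Proof.
move=> red.
have [/existsP[b nzb] | /existsPn row0] := boolP [exists b, entry lam m b != 0];
    last first.
  exists 1%g, 1%g; rewrite lact1 ract1 => i j.
  rewrite ltnS leq_eqVlt => /orP[/eqP/val_inj -> | ]; last exact: red.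
  by move=> nzj; have := row0 j; rewrite nzj.
have [k nzk kmax] :=
  @arg_maxnP _ b (fun c => entry lam m c != 0) (@nat_of_ord n) nzb.
have {}kmax (j : 'I_n) : (k < j)%N -> entry lam m j = 0.
  by move=> ltkj; apply: contraTeq ltkj => /kmax; rewrite -leqNgt.
have ltmk := entry_neq0_lt nzk.
have above0 (i : 'I_n) : (i < m)%N -> entry lam i k = 0.
  move=> ltim; apply: contraTeq ltim => nzi; apply/negP => ltim.
  by have [_ /(_ _ nzk) em] := red _ _ ltim nzi; rewrite em ltnn in ltim.
(* Column operations clear row m to the left of k. *)
pose g := unitri_of_fun
  (fun a c => if c == k then - entry lam m a / entry lam m k else 0).
pose lam1 := lact g lam.
have lam1E (i j : 'I_n) : entry lam1 i j = entry lam i j +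
    (if (i < j < k)%N then - entry lam m j / entry lam m k * entry lam i k
     else 0).
  case: (ltnP i j) => [ltij|leji].
    by rewrite /lam1 (entry_lact_col (fun a => - entry lam m a / entry lam m k)).
  by rewrite /= addr0 !entry_ge.
have lam1_above (i j : 'I_n) : (i < m)%N -> entry lam1 i j = entry lam i j.
  by move=> ltim; rewrite lam1E (above0 i) // mulr0 if_same addr0.
have lam1_row (j : 'I_n) : entry lam1 m j = if j == k then entry lam m k else 0.
  rewrite lam1E; case: eqVneq => [->|njk]; first by rewrite ltnn andbF addr0.
  case: (ltnP m j) => [ltmj|lejm] /=; last by rewrite entry_ge ?addr0.
  rewrite divfK //; case: ltnP => [|lekj]; first by rewrite subrr.
  by rewrite addr0 kmax // ltn_neqAle lekj andbT eq_sym.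
(* Row operations clear column k below row m. *)
pose h := unitri_of_fun
  (fun c a => if c == m then - entry lam1 a k / entry lam1 m k else 0).
pose lam2 := ract lam1 h.
have lam2E (i j : 'I_n) : entry lam2 i j = entry lam1 i j +
    (if (m < i < j)%N then - entry lam1 i k / entry lam1 m k * entry lam1 m j
     else 0).
  case: (ltnP i j) => [ltij|leji].
    rewrite andbT /lam2.
    by rewrite (entry_ract_row (fun a => - entry lam1 a k / entry lam1 m k)).
  by rewrite andbF addr0 !entry_ge.
have lam2_above (i j : 'I_n) : (i <= m)%N -> entry lam2 i j = entry lam1 i j.
  by move=> leim; rewrite lam2E ltnNge leim addr0.
have lam2_below (i j : 'I_n) : (m < i)%N ->
    entry lam2 i j = if j == k then 0 else entry lam1 i j.
  move=> ltmi; rewrite lam2E ltmi (lam1_row j).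
  case: eqVneq => [->|nkj] /=; last by rewrite mulr0 if_same addr0.
  rewrite (lam1_row k) eqxx divfK //.
  case: ltnP => [|leki]; first by rewrite subrr.
  by rewrite entry_ge ?addr0.
suff red2 : reduced_above m.+1 lam2 by exists g, h.
clearbody lam2 lam1; clear g h.
move=> i j; rewrite ltnS leq_eqVlt => /orP[/eqP/val_inj -> | ltim].
  rewrite lam2_above // lam1_row.
  case: (eqVneq j k) => [-> _|_]; last by rewrite eqxx.
  split=> c.
    by rewrite lam2_above // lam1_row; case: (eqVneq c k); rewrite // eqxx.
  case: (ltngtP c m) => [ltcm|ltmc|/val_inj //].
    by rewrite lam2_above 1?ltnW // lam1_above // above0 // eqxx.
  by rewrite lam2_below // !eqxx.
rewrite lam2_above 1?ltnW // lam1_above // => nzij.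
have [row col] := red _ _ ltim nzij.
split=> c; first by rewrite lam2_above 1?ltnW // lam1_above //; apply: row.
have njk : j == k = false by apply: contraNF nzij => /eqP ->; rewrite above0.
have mj0 : entry lam m j = 0.
  by apply: contraTeq ltim => /col ->; rewrite ltnn.
case: (ltngtP c m) => [ltcm|ltmc|/val_inj ->].
- by rewrite lam2_above 1?ltnW // lam1_above //; apply: col.
- by rewrite lam2_below // njk lam1E mj0 oppr0 !mul0r if_same addr0; apply: col.
by rewrite lam2_above // lam1_row njk eqxx.
Qed.

Lemma template_exists lam : exists g h, is_template (ract (lact g lam) h).
Proof.
suff [g [h red]] : exists g h, reduced_above n (ract (lact g lam) h).
  exists g, h; apply/is_templateP; split=> [i j k nzj nzk | i k j nzi nzk].
    by have [row _] := red _ _ (ltn_ord i) nzk; apply: row.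
  by have [_ col] := red _ _ (ltn_ord k) nzk; apply: col.
suff red m : (m <= n)%N -> exists g h, reduced_above m (ract (lact g lam) h).
  exact: red.
elim: m => [_|m IHm ltmn]; first by exists 1%g, 1%g => i j.
have [g [h red]] := IHm (ltnW ltmn).
have [g' [h' red']] := reduce_row (m := Ordinal ltmn) red.
exists (g' * g)%g, (h * h')%g.
by rewrite lactM ractM -lact_ract.
Qed.

(** Induction on the distance of a position (i, j) to the upper right corner.  If the
    equation at (i, j) involves a nonzero entry of tau to the right, it is also
    an entry of sigma, and both templates vanish at (i, j); likewise for a
    nonzero entry of sigma above.  Otherwise the equation reads
    tau i j = sigma i j. *)
Lemma template_unique tau sigma g h : is_template tau -> is_template sigma ->
  lact g tau = ract sigma h -> tau = sigma.
Proof.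
move=> /is_templateP[row_t col_t] /is_templateP[row_s col_s] eq_ts.
apply: entry_inj.
suff IH N : forall i j : 'I_n, (i + (n - j) < N)%N ->
    entry tau i j = entry sigma i j.
  by move=> i j; apply: (IH _ i j (ltnSn _)).
elim: N => // N IHN i j; rewrite ltnS => leN.
have [ltij|leji] := ltnP i j; last by rewrite !entry_ge.
have IHr (k : 'I_n) : (j < k)%N -> entry tau i k = entry sigma i k.
  move=> ltjk; apply: IHN; apply: leq_trans leN.
  by rewrite ltn_add2l ltn_sub2l // (ltn_trans ltjk).
have IHc (k : 'I_n) : (k < i)%N -> entry tau k j = entry sigma k j.
  by move=> ltki; apply: IHN; apply: leq_trans leN; rewrite ltn_add2r.
have [/existsP[k /andP[ltjk nzk]]|] :=
    boolP [exists k : 'I_n, (j < k)%N && (entry tau i k != 0)].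
  have zero (lam : dual n F) :
      (forall i j k, entry lam i j != 0 -> entry lam i k != 0 -> j = k) ->
      entry lam i k != 0 -> entry lam i j = 0.
    move=> row nz; apply: contraTeq ltjk => /row/(_ nz) ->; by rewrite ltnn.
  by rewrite !zero // -IHr.
rewrite negb_exists => /forallP row0.
have [/existsP[k /andP[ltki nzk]]|] :=
    boolP [exists k : 'I_n, (k < i)%N && (entry sigma k j != 0)].
  have zero (lam : dual n F) :
      (forall i k j, entry lam i j != 0 -> entry lam k j != 0 -> i = k) ->
      entry lam k j != 0 -> entry lam i j = 0.
    move=> col nz; apply: contraTeq ltki => /col/(_ nz) ->; by rewrite ltnn.
  by rewrite !zero // IHc.
rewrite negb_exists => /forallP col0.
have := congr1 (fun lam => entry lam i j) eq_ts.
rewrite entry_lact // entry_ract // !big1 ?addr0 // => k ltk.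
  by have := col0 k; rewrite ltk /= negbK => /eqP ->; rewrite mulr0.
by have := row0 k; rewrite ltk /= negbK => /eqP ->; rewrite mulr0.
Qed.

(** The entry of tau h - tau at (i, j) is h a i * tau a j, for the row a < i of the
    nonzero entry of tau in column j.  Distinct columns have distinct rows a, so
    the coefficients h a i can be prescribed independently. *)
Lemma mem_Rhat_template tau mu : is_template tau ->
  reflect (forall i j, entry mu i j != 0 ->
             exists2 a : 'I_n, (a < i)%N & entry tau a j != 0)
          (mu \in Rhat tau).
Proof.
move=> /is_templateP[row col].
apply: (iffP imsetP) => [[_ /imsetP[h _ ->] ->] i j nz | ex].
  have ltij := entry_neq0_lt nz.
  apply/exists_inP; apply: contraNT nz => /exists_inPn no.
  rewrite entryB entry_ract // addrC addKr big1 // => a /no.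
  by rewrite negbK => /eqP ->; apply: mulr0.
(* Row a of tau has at most one nonzero entry, and division by 0 gives 0, so at
   most one term of the sum is nonzero. *)
pose h := unitri_of_fun (fun a i => \sum_b entry mu i b / entry tau a b).
exists (ract tau h); first by apply/imsetP; exists h.
apply: entry_inj => i j; rewrite entryB.
have [ltij|leji] := ltnP i j; last by rewrite !entry_ge // subr0.
rewrite entry_ract // addrC addKr.
have hE (a : 'I_n) : (a < i)%N -> entry tau a j != 0 ->
    h a i = entry mu i j / entry tau a j.
  move=> ltai nza.
  rewrite unitri_of_funE // (bigD1 j) //= big1 ?addr0 // => b nbj.
  suff -> : entry tau a b = 0 by rewrite invr0 mulr0.
  by apply: contraNeq nbj => /row/(_ nza) ->.
have [/eqP mu0|/[dup] nz /ex[a ltai nza]] := boolP (entry mu i j == 0).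
  rewrite mu0 big1 // => a ltai; case: (eqVneq (entry tau a j) 0) => [->|nza].
    by rewrite mulr0.
  by rewrite hE // mu0 !mul0r.
rewrite (bigD1 a) //= hE // divfK // big1 ?addr0 // => c /andP[_ nca].
suff -> : entry tau c j = 0 by rewrite mulr0.
by apply: contraNeq nca => /col/(_ nza) ->.
Qed.

End Templates.

(** * Subspaces, orbits and their cardinalities *)

Section Subspaces.
Variables (n : nat) (F : finFieldType).
Implicit Types (lam mu tau sigma : dual n F) (g h : unitri n F).
Implicit Types (A B : {set dual n F}).

(** A set of forms that is a linear subspace: the sets to which [dimset] applies. *)
Definition linear_set A : Prop :=
  0 \in A /\ forall a x y, x \in A -> y \in A -> a *: x + y \in A.

Lemma linear_set_sum A (I : finType) (f : I -> dual n F) :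
  linear_set A -> (forall i, f i \in A) -> \sum_i f i \in A.
Proof.
move=> [A0 AD] Af; elim/big_ind: _ => [|x y Ax Ay|i _] //.
by rewrite -[x]scale1r AD.
Qed.

Lemma linear_setI A B : linear_set A -> linear_set B -> linear_set (A :&: B).
Proof.
move=> [A0 AD] [B0 BD]; split=> [|a x y]; first by rewrite inE A0.
by rewrite !inE => /andP[Ax Bx] /andP[Ay By]; rewrite AD ?BD.
Qed.

Lemma card_linear_set A : linear_set A -> #|A| = (#|F| ^ dimset A)%N.
Proof.
move=> linA; rewrite -card_vspace; apply: eq_card => x; apply/idP/idP => [Ax|].
  by rewrite memv_span ?mem_enum.
have [A0 AD] := linA; have AZ a y : y \in A -> a *: y \in A.
  by move=> Ay; rewrite -[_ *: _]addr0 AD.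
move=> /(coord_span (X := in_tuple (enum A))) ->.
apply: linear_set_sum => // i; apply: AZ.
by rewrite -mem_enum mem_nth.
Qed.

Lemma mem_Lhat lam mu :
  reflect (exists g, mu = lact g lam - lam) (mu \in Lhat lam).
Proof.
apply: (iffP imsetP) => [[_ /imsetP[g _ ->] ->]|[g ->]]; first by exists g.
by exists (lact g lam) => //; apply/imsetP; exists g.
Qed.

Lemma mem_Rhat lam mu :
  reflect (exists h, mu = ract lam h - lam) (mu \in Rhat lam).
Proof.
apply: (iffP imsetP) => [[_ /imsetP[g _ ->] ->]|[g ->]]; first by exists g.
by exists (ract lam g) => //; apply/imsetP; exists g.
Qed.

(** The set of differences g - 1 is a linear space, which makes the translated
    orbits linear. *)
Lemma is_unitri_lin a g h :
  is_unitri (1%:M + (a *: (unitri_mx g - 1%:M) + (unitri_mx h - 1%:M))).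
Proof.
by apply/is_unitri_add1/strict_upperZD; apply: unitri_sub1_strict_upper.
Qed.

Lemma Lhat_linear lam : linear_set (Lhat lam).
Proof.
split; first by apply/mem_Lhat; exists 1%g; rewrite lact1 subrr.
move=> a _ _ /mem_Lhat[g ->] /mem_Lhat[h ->]; apply/mem_Lhat.
exists (Unitri (is_unitri_lin a g h)); apply: dual_eqP => X uX.
rewrite evmDl !evmBl !evm_lact //=.
rewrite mulmxDr mulmx1 mulmxDr -scalemxAr !mulmxBr mulmx1.
have linB Y Z : evm lam (Y - Z) = evm lam Y - evm lam Z by exact: linearB.
transitivity (evm lam (a *: (X *m unitri_mx g - X) + (X *m unitri_mx h - X))).
  transitivity
      (a * evm lam (X *m unitri_mx g - X) + evm lam (X *m unitri_mx h - X)).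
    by rewrite !linB.
  exact/esym/linearP.
by rewrite -linB; congr evm; rewrite [RHS]addrC addKr.
Qed.

Lemma Rhat_linear lam : linear_set (Rhat lam).
Proof.
split; first by apply/mem_Rhat; exists 1%g; rewrite ract1 subrr.
move=> a _ _ /mem_Rhat[g ->] /mem_Rhat[h ->]; apply/mem_Rhat.
exists (Unitri (is_unitri_lin a g h)); apply: dual_eqP => X uX.
rewrite evmDl !evmBl !evm_ract //=.
rewrite mulmxDl mul1mx mulmxDl -scalemxAl !mulmxBl mul1mx.
have linB Y Z : evm lam (Y - Z) = evm lam Y - evm lam Z by exact: linearB.
transitivity (evm lam (a *: (unitri_mx g *m X - X) + (unitri_mx h *m X - X))).
  transitivity
      (a * evm lam (unitri_mx g *m X - X) + evm lam (unitri_mx h *m X - X)).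
    by rewrite !linB.
  exact/esym/linearP.
by rewrite -linB; congr evm; rewrite [RHS]addrC addKr.
Qed.

Lemma row_set_linear tau (k : 'I_n) :
  linear_set [set mu in Rhat tau | [forall p in supp mu, p.1 == k]].
Proof.
have [R0 RD] := Rhat_linear tau.
have rowP mu : reflect (forall i j, i != k -> entry mu i j = 0)
    [forall p in supp mu, p.1 == k].
  apply: (iffP forall_inP) => [row i j nik|row [i j]].
    by apply: contraNeq nik => nz; apply: (row (i, j)); rewrite mem_supp.
  by rewrite mem_supp; apply: contraNT => /= /row ->.
split=> [|a x y]; first by rewrite inE R0; apply/rowP => i j _; rewrite entry0.
move=> /setIdP[Rx /rowP x0] /setIdP[Ry /rowP y0]; apply/setIdP.
split; first exact: RD.
by apply/rowP => i j nik; rewrite entryD x0 // y0 // mulr0 addr0.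
Qed.

Lemma card_Lhat lam : #|Lhat lam| = #|Lorbit lam|.
Proof. by rewrite card_imset //; apply: addIr. Qed.

Lemma card_Rhat lam : #|Rhat lam| = #|Rorbit lam|.
Proof. by rewrite card_imset //; apply: addIr. Qed.

Lemma card_LhatI lam : #|Lhat lam :&: Rhat lam| = #|Lorbit lam :&: Rorbit lam|.
Proof.
have inj : injective (fun mu => mu - lam) by apply: addIr.
by rewrite -[RHS](card_imset _ inj) imsetI // => x y _ _ /inj.
Qed.

End Subspaces.

Section Orbits.
Variables (n : nat) (F : finFieldType).
Implicit Types (lam mu tau sigma : dual n F) (g h : unitri n F).
Implicit Types (A B : {set dual n F}).

Lemma card_preim_fibers (T S : finType) (f : T -> S) (c : nat) (A : {set S}) :
    (forall x, #|[set y | f y == f x]| = c) ->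
  #|[set x | f x \in A]| = (#|A :&: f @: T| * c)%N.
Proof.
move=> fib; rewrite -sum_nat_const -sum1_card.
rewrite (partition_big f [in A :&: f @: T]).
  apply: eq_bigr => y /setIP[Ay /imsetP[x _ ey]]; subst y.
  rewrite -(fib x) -sum1_card.
  by apply: eq_bigl => z; rewrite !inE; case: eqP => [->|]; rewrite ?andbF ?Ay.
by move=> x; rewrite !inE => ->; apply: imset_f.
Qed.

Lemma card_ract_preim lam A :
  #|[set h | ract lam h \in A]| =
  (#|A :&: Rorbit lam| * #|[set h | ract lam h == lam]|)%N.
Proof.
apply: card_preim_fibers => h.
rewrite -(card_imset [set y | ract lam y == lam] (mulIg h)).
apply: eq_card => y.
rewrite inE; apply/eqP/imsetP => [e|[k]]; last rewrite inE => /eqP e ->.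
  by exists (y * h^-1)%g; rewrite ?mulgKV // inE ractM e ractK.
by rewrite ractM e.
Qed.

Lemma card_lact_preim lam A :
  #|[set g | lact g lam \in A]| =
  (#|A :&: Lorbit lam| * #|[set g | lact g lam == lam]|)%N.
Proof.
apply: (card_preim_fibers (f := fun g => lact g lam)) => h.
rewrite -(card_imset [set y | lact y lam == lam] (mulgI h)).
apply: eq_card => y.
rewrite inE; apply/eqP/imsetP => [e|[k]]; last rewrite inE => /eqP e ->.
  by exists (h^-1 * y)%g; rewrite ?mulKVg // inE lactM e lactK.
by rewrite lactM e.
Qed.

(** The stabilisers of lam on the two sides have the same order. *)
Lemma card_Lorbit_Rorbit (C : numClosedFieldType) (theta : F -> C) lam :
  nontrivial_additive_char theta -> #|Lorbit lam| = #|Rorbit lam|.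
Proof.
move=> theta_char; have := card_lact_preim lam setT.
have := card_ract_preim lam setT.
rewrite !setTI (card_stab_lact_ract theta_char lam).
have -> : [set g | lact g lam \in setT] = [set h | ract lam h \in setT].
  by apply/setP => g; rewrite !inE.
move=> -> /eqP; rewrite eqn_pmul2r => [/eqP //|].
by apply/card_gt0P; exists 1%g; rewrite inE ract1.
Qed.

End Orbits.

(** * The right orbit of a template, row by row *)

Section TemplateRows.
Variables (n : nat) (F : finFieldType) (tau : dual n F).
Hypothesis tau_template : is_template tau.
Implicit Types (mu : dual n F) (Z : {set 'I_n}).

Let rows (k : 'I_n) : {set dual n F} :=
  [set mu in Rhat tau | [forall p in supp mu, p.1 == k]].

Lemma mem_rows k mu : mu \in rows k ->
  mu \in Rhat tau /\ forall i j, i != k -> entry mu i j = 0.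
Proof.
case/setIdP=> Rmu /forall_inP row; split=> // i j nik.
by apply: contraNeq nik => nz; apply: (row (i, j)); rewrite mem_supp.
Qed.

Lemma entry_sum (f : 'I_n -> dual n F) i j :
  entry (\sum_k f k) i j = \sum_k entry (f k) i j.
Proof.
apply: (big_morph (fun lam => entry lam i j)) => [x y|]; last exact: entry0.
by rewrite -[x]scale1r entryD mul1r scale1r.
Qed.

Lemma entry_sum_rows (f : 'I_n -> dual n F) i j :
  (forall k, f k \in rows k) -> entry (\sum_k f k) i j = entry (f i) i j.
Proof.
move=> rf; rewrite entry_sum (bigD1 i) //= big1 ?addr0 // => k nki.
by have [_ ->] := mem_rows (rf k); rewrite // eq_sym.
Qed.

Definition row_part mu (k : 'I_n) : dual n F :=
  dual_of_mx (\matrix_(i, j) if i == k then entry mu i j else 0).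

Lemma entry_row_part mu k i j :
  entry (row_part mu k) i j = if i == k then entry mu i j else 0.
Proof.
case: (ltnP i j) => [ltij|leji]; first by rewrite entry_dual_of_mx // mxE.
by rewrite !entry_ge // if_same.
Qed.

Lemma row_part_rows mu k : mu \in Rhat tau -> row_part mu k \in rows k.
Proof.
move=> /(mem_Rhat_template _ tau_template) Rmu; apply/setIdP; split.
  apply/(mem_Rhat_template _ tau_template) => i j; rewrite entry_row_part.
  by case: (eqVneq i k) => [->|_]; [apply: Rmu | rewrite eqxx].
apply/forall_inP => p; rewrite mem_supp entry_row_part.
by case: ifP; rewrite ?eqxx.
Qed.

Lemma sum_row_part mu : \sum_k row_part mu k = mu.
Proof.
apply: entry_inj => i j; rewrite entry_sum (bigD1 i) //= entry_row_part eqxx.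
by rewrite big1 ?addr0 // => k nki; rewrite entry_row_part eq_sym (negPf nki).
Qed.

(** Forms in the translated right orbit are sums of independent row components;
    each row of Z loses its zero component. *)
Lemma card_nonzero_rows Z :
  #|[set mu in Rhat tau | [forall k in Z, [exists j, entry mu k j != 0]]]| =
  (\prod_k (#|rows k| - (k \in Z)))%N.
Proof.
pose W k := if k \in Z then rows k :\ 0 else rows k.
have WS k : {subset W k <= rows k}.
  by move=> mu; rewrite /W; case: ifP => // _ /setD1P[].
have cardW k : (#|rows k| - (k \in Z))%N = #|W k|.
  have [row0 _] := row_set_linear tau k.
  rewrite /W; case: ifP => _; rewrite ?subn0 // [#|rows k|](cardsD1 0).
  by rewrite row0 addKn.
under eq_bigr do rewrite cardW.
pose total (f : {ffun 'I_n -> dual n F}) := \sum_k f k.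
transitivity #|total @: family (fun k => [in W k])|.
  apply: eq_card => mu; apply/setIdP/imsetP => [[Rmu /forall_inP nz]|].
    exists [ffun k => row_part mu k]; last first.
      by rewrite /total; under eq_bigr do rewrite ffunE; rewrite sum_row_part.
    apply/familyP => k; rewrite ffunE -[_ \in _]/(_ \in W k) /W.
    case: ifP => [Zk|_]; last exact: row_part_rows.
    apply/setD1P; split; last exact: row_part_rows.
    have /existsP[j nzj] := nz k Zk; apply: contraNneq nzj => mu0.
    by have := entry_row_part mu k k j; rewrite mu0 entry0 eqxx => <-.
  case=> f /familyP Wf ->; have rf k : f k \in rows k by apply: WS; apply: Wf.
  split.
    by apply: linear_set_sum (Rhat_linear tau) _ => k; case: (mem_rows (rf k)).
  apply/forall_inP => k Zk.
  have := Wf k; rewrite -[_ \in _]/(_ \in W k) /W Zk => /setD1P[nz0 _].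
  apply: contraR nz0 => /existsPn no; apply/eqP/entry_inj => i j.
  rewrite entry0; have [_ row] := mem_rows (rf k).
  case: (eqVneq i k) => [->|/row //]; rewrite -(entry_sum_rows _ _ rf).
  by apply/eqP/negPn/no.
rewrite card_in_imset => [|f f' /familyP Wf /familyP Wf' ef].
  by rewrite card_family foldrE big_map big_enum.
have rf k : f k \in rows k by apply: WS; apply: Wf.
have rf' k : f' k \in rows k by apply: WS; apply: Wf'.
apply/ffunP => k; apply: entry_inj => i j; case: (eqVneq i k) => [->|nik].
  by rewrite -(entry_sum_rows _ _ rf) -/(total f) ef entry_sum_rows.
by have [_ ->] := mem_rows (rf k) => //; have [_ ->] := mem_rows (rf' k).
Qed.

Lemma mem_Delta mu : (mu \in Delta n F) =
  [forall k : 'I_n, (k.+1 < n)%N ==> [exists j, entry mu k j != 0]].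
Proof.
rewrite inE; apply: eq_forallb => k; congr (_ ==> _); apply/exists_inP/existsP.
  by case=> -[i j]; rewrite mem_supp /= => nz /eqP <-; exists j.
by case=> j nz; exists (k, j); rewrite ?mem_supp.
Qed.

(** A row of tau with a nonzero entry stays nonzero in mu + tau: the entry lies in a
    column of its own, where mu vanishes down to that row. *)
Lemma Delta_add_template mu : mu \in Rhat tau -> (mu + tau \in Delta n F) =
  [forall k in empty_rows tau, [exists j, entry mu k j != 0]].
Proof.
move=> /(mem_Rhat_template _ tau_template) Rmu; rewrite mem_Delta.
have entE k j : entry (mu + tau) k j = entry mu k j + entry tau k j.
  by rewrite -{1}[mu]scale1r entryD mul1r.
have [_ col] := is_templateP _ tau_template.
apply/forallP/forall_inP => [D k | N k].
  rewrite inE => /andP[ltk /forall_inP empty].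
  have /existsP[j nz] := implyP (D k) ltk; apply/existsP; exists j.
  move: nz; rewrite entE; suff -> : entry tau k j = 0 by rewrite addr0.
  apply/eqP; apply: contraT => nz.
  by have := empty (k, j); rewrite mem_supp nz eqxx => /(_ isT).
apply/implyP => ltk; have [Zk|] := boolP (k \in empty_rows tau).
  have /existsP[j nz] := N k Zk; apply/existsP; exists j; rewrite entE.
  suff -> : entry tau k j = 0 by rewrite addr0.
  move: Zk; rewrite inE => /andP[_ /forall_inP empty].
  apply/eqP; apply: contraT => nz'.
  by have := empty (k, j); rewrite mem_supp nz' eqxx => /(_ isT).
rewrite inE ltk /= => /forall_inPn[[i j]].
rewrite mem_supp /= negbK => nz /eqP ek.
rewrite {i}ek in nz *; apply/existsP; exists j; rewrite entE.
suff -> : entry mu k j = 0 by rewrite add0r.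
apply/eqP; apply: contraT => /Rmu[a ltak nza].
by rewrite (col _ _ _ nza nz) ltnn in ltak.
Qed.

Lemma card_rows k : #|rows k| = (#|F| ^ row_dim k tau)%N.
Proof. exact/card_linear_set/row_set_linear. Qed.

(** The product over all rows, with no row required to be nonzero. *)
Lemma card_Rorbit_template : #|Rorbit tau| = (\prod_k #|F| ^ row_dim k tau)%N.
Proof.
rewrite -card_Rhat; under eq_bigr do rewrite -card_rows -[#|_|]subn0.
have := card_nonzero_rows set0; under [in X in _ = X]eq_bigr do rewrite inE.
move=> <-; apply: eq_card => mu; rewrite inE.
by case: (mu \in _) => //=; apply/esym/forall_inP => k; rewrite inE.
Qed.

Lemma card_Delta_Rorbit : #|Delta n F :&: Rorbit tau| =
  (\prod_k (#|F| ^ row_dim k tau - (k \in empty_rows tau)))%N.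
Proof.
under eq_bigr do rewrite -card_rows.
rewrite -card_nonzero_rows -[RHS](card_imset _ (addIr tau)).
apply: eq_card => mu.
apply/setIP/imsetP => [[Dmu Rmu]|[nu /setIdP[Rnu Nnu] ->]].
  have Rh : mu - tau \in Rhat tau by apply/imsetP; exists mu.
  exists (mu - tau); rewrite ?subrK //; apply/setIdP; split=> //.
  by rewrite -Delta_add_template // subrK.
split; first by rewrite Delta_add_template.
by case/imsetP: Rnu => nu' R ->; rewrite subrK.
Qed.

End TemplateRows.

(** * Multiplicities *)

Section Multiplicities.
Variables (n : nat) (F : finFieldType) (C : numClosedFieldType).
Variables (theta : F -> C) (theta_char : nontrivial_additive_char theta).
Implicit Types (lam mu tau sigma : dual n F) (g h : unitri n F).
Implicit Types (A : {set dual n F}).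

(** Each h contributes the single form tau h^-1, if it belongs to A. *)
Lemma vcoef_submodule_char A tau :
    (forall g mu, mu \in A -> lact g mu \in A) ->
  #|[set: unitri n F]|%:R * vcoef theta tau (submodule_char (vspan theta A)) =
  #|[set h | ract tau h \in A]|%:R.
Proof.
move=> stA.
rewrite -vcoefZ submodule_char_ract // linear_sum.
under eq_bigr do rewrite linear_sum.
rewrite exchange_big (reindex_inj invg_inj) /= -sum1_card natr_sum.
rewrite [RHS]big_mkcond.
apply: eq_bigr => h _; rewrite inE.
under eq_bigr do rewrite vcoef_vfun // (can2_eq (ractVK h) (ractK h)).
rewrite big_mkcond (bigD1 (ract tau h)) //= eqxx.
rewrite big1 => [|mu /negPf ->]; last exact: if_same.
by rewrite addr0; case: ifP.
Qed.

Lemma cluster_char_template lam : exists2 tau, is_template tau &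
  cluster_char theta lam = cluster_char theta tau.
Proof.
have [g [h t]] := template_exists lam; exists (ract (lact g lam) h) => //.
by rewrite cluster_char_twosided.
Qed.

Lemma cluster_sum_expands (s : seq (dual n F)) : exists m : dual n F -> C,
  \sum_(lam <- s) cluster_char theta lam =
  \sum_(sigma | is_template sigma) m sigma *: cluster_char theta sigma.
Proof.
pose T lam := odflt lam [pick tau | is_template tau &
  cluster_char theta tau == cluster_char theta lam].
have TP lam : is_template (T lam) /\
    cluster_char theta (T lam) = cluster_char theta lam.
  rewrite /T; case: pickP => [tau /andP[? /eqP] //|none].
  have [tau t e] := cluster_char_template lam.
  by have := none tau; rewrite t e eqxx.
exists (fun sigma => \sum_(lam <- s | T lam == sigma) 1).
rewrite (partition_big T (@is_template n F)) /= => [|lam _]; last first.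
  by case: (TP lam).
apply: eq_bigr => sigma _; rewrite scaler_suml; apply: eq_bigr => lam /eqP <-.
by rewrite scale1r; case: (TP lam).
Qed.

Lemma vcoef_cluster_char tau sigma : is_template tau -> is_template sigma ->
  tau != sigma -> vcoef theta tau (cluster_char theta sigma) = 0.
Proof.
move=> t_tau t_sigma ne; apply: (mulfI (cardU_neq0 n F C)).
rewrite mulr0 vcoef_submodule_char => [|g mu]; last exact: mem_Lorbit_lact.
apply/eqP; rewrite pnatr_eq0 cards_eq0 -subset0; apply/subsetP => h.
rewrite inE => /imsetP[g _ e]; case/eqP: ne; apply/esym.
exact: template_unique t_sigma t_tau (esym e).
Qed.

(** Only the term of tau survives in the coefficient of v(tau); both sides then
    carry the order of the right stabiliser of tau as a factor. *)
Lemma template_multiplicity (m : dual n F -> C) tau : is_template tau ->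
  discrete_series_char n theta =
    \sum_(sigma | is_template sigma) m sigma *: cluster_char theta sigma ->
  m tau * #|Lorbit tau :&: Rorbit tau|%:R = #|Delta n F :&: Rorbit tau|%:R.
Proof.
move=> t_tau /(congr1 (vcoef theta tau)).
rewrite linear_sum (bigD1 tau) //= big1 => [|sigma /andP[t ne]]; last first.
  by rewrite vcoefZ vcoef_cluster_char 1?eq_sym // mulr0.
rewrite addr0 vcoefZ => /(congr1 (fun x => #|[set: unitri n F]|%:R * x)).
rewrite vcoef_submodule_char; last exact: Delta_lact.
rewrite mulrCA vcoef_submodule_char => [|g mu]; last exact: mem_Lorbit_lact.
rewrite !card_ract_preim !natrM mulrA => /mulIf -> //.
by rewrite pnatr_eq0 -lt0n; apply/card_gt0P; exists 1%g; rewrite inE ract1.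
Qed.

Lemma card_Delta_Rorbit_ratio tau : is_template tau ->
  #|Delta n F :&: Rorbit tau|%:R =
  #|F|%:R ^+ d_dim tau *
    \prod_(k in empty_rows tau) (1 - 1 / #|F|%:R ^+ row_dim k tau) :> C.
Proof.
move=> t_tau; have nzq d : (#|F| ^ d)%:R != 0 :> C.
  by rewrite natrX expf_neq0 // pnatr_eq0; case: #|F| (finNzRing_gt1 F).
rewrite card_Delta_Rorbit // -natrX -(card_linear_set (Lhat_linear tau)) card_Lhat.
rewrite (card_Lorbit_Rorbit _ theta_char) card_Rorbit_template // !natr_prod.
rewrite [X in _ * X]big_mkcond -big_split; apply: eq_bigr => k _ /=.
rewrite -natrX; case: ifP => _; last by rewrite subn0 mulr1.
by rewrite natrB ?lt0n -?(pnatr_eq0 C) // mulrBr mulr1 mulrA mulr1 divff.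
Qed.

End Multiplicities.

Theorem theorem8p4 (R : realType) (n : nat) (F : finFieldType) (theta : F -> R[i])
    (n_ge1 : (1 <= n)%N) (theta_char : nontrivial_additive_char theta) :
  (exists s : seq (dual n F),
     discrete_series_char n theta = \sum_(lam <- s) cluster_char theta lam) /\
  (forall tau : dual n F, is_template tau ->
     cluster_multiplicity theta (discrete_series_char n theta) tau
       (#|F|%:R ^+ (d_dim tau - i_dim tau) *
        \prod_(k in empty_rows tau) (1 - 1 / #|F|%:R ^+ row_dim k tau))).
Proof.
have [s sE] := discrete_series_sum_cluster n theta_char.
split=> [|tau t_tau]; first by exists s.
split=> [|m mE]; first by rewrite sE; apply: cluster_sum_expands.
have nzq : #|F|%:R != 0 :> R[i].
  by rewrite pnatr_eq0; case: #|F| (finNzRing_gt1 F).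
have := template_multiplicity theta_char t_tau mE.
rewrite (card_Delta_Rorbit_ratio theta_char) // -card_LhatI.
rewrite (card_linear_set (linear_setI (Lhat_linear tau) (Rhat_linear tau))).
rewrite -/(i_dim tau) natrX.
move=> /(canRL (mulfK (expf_neq0 _ nzq))) ->.
by rewrite mulrAC expfB_cond ?(negPf nzq) ?i_dim_le_d_dim.
Qed.
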